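(* As $n\to\infty$, $\tilde r(n)\ge 2^{(2-\sqrt2)n-O(1)}$; that is, there is an absolute constant $C$ such that $\tilde r(n)\ge 2^{(2-\sqrt2)n-C}$ for all sufficiently large integers $n$.
   Context: The $(m,n)$-online Ramsey game is played by two players, Builder and Painter, on an infinite set of initially isolated vertices. Each turn, Builder places an edge between two nonadjacent vertices and Painter immediately paints it red or blue. The online Ramsey number $\tilde r(m,n)$ is the smallest number of turns within which Builder can guarantee the existence of either a red $K_m$ or a blue $K_n$, whatever Painter does. The diagonal online Ramsey number is $\tilde r(n):=\tilde r(n,n)$. *)

(* Defs.v *)
From mathcomp Require Import all_boot all_order all_algebra.
From mathcomp Require Import boolp reals exp.

Set Implicit Arguments.
Unset Strict Implicit.
Unset Printing Implicit Defensive.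

(* The infinite vertex set of the board is nat. *)

Notation Red := true (only parsing).
Notation Blue := false (only parsing).

(* The painted edges, latest first; (u, v, c) and (v, u, c) stand for the same
   edge uv painted c. *)
Definition history := seq (nat * nat * bool).

Definition painted (h : history) (c : bool) (u v : nat) : bool :=
  ((u, v, c) \in h) || ((v, u, c) \in h).

Definition adjacent (h : history) (u v : nat) : bool :=
  painted h Red u v || painted h Blue u v.

Definition legal (h : history) (e : nat * nat) : bool :=
  (e.1 != e.2) && ~~ adjacent h e.1 e.2.

Definition mono_clique (h : history) (c : bool) (k : nat) : Prop :=
  exists s : seq nat, [/\ uniq s, size s = k &
    {in s &, forall u v, u != v -> painted h c u v}].

(* The board is infinite, so a legal move exists after every history and
   legality can be required everywhere. *)
Record builder := Builder {
  move_of :> history -> nat * nat;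
  move_of_legal : forall h, legal h (move_of h)
}.

Definition painter := history -> nat * nat -> bool.

Fixpoint play (B : builder) (P : painter) (t : nat) : history :=
  if t is t'.+1 then
    let h := play B P t' in (B h, P h (B h)) :: h
  else [::].

Definition builder_forces (m n t : nat) : Prop :=
  exists B : builder, forall P : painter, exists2 k, k <= t &
    mono_clique (play B P k) Red m \/ mono_clique (play B P k) Blue n.

Lemma ramsey_bound (m n : nat) : exists N, forall (h : history) (s : seq nat),
  uniq s -> N <= size s ->
  {in s &, forall u v, u != v -> adjacent h u v} ->
  mono_clique h Red m \/ mono_clique h Blue n.
Proof.
suff: forall a m n, m + n <= a -> exists N, forall (h : history) (s : seq nat),
  uniq s -> N <= size s -> {in s &, forall u v, u != v -> adjacent h u v} ->
  (exists r, [/\ uniq r, size r = m, {subset r <= s} &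
    {in r &, forall u v, u != v -> painted h Red u v}]) \/
  (exists r, [/\ uniq r, size r = n, {subset r <= s} &
    {in r &, forall u v, u != v -> painted h Blue u v}]).
  move=> /(_ _ m n (leqnn _)) [N HN]; exists N => h s us Ns hs.
  by case: (HN h s us Ns hs) => -[r [? ? _ ?]]; [left|right]; exists r.
elim=> [|a IH] {}m {}n.
  rewrite leqn0 addn_eq0 => /andP[/eqP-> _].
  by exists 0 => h s _ _ _; left; exists [::].
case: m => [_|m]; first by exists 0 => h s _ _ _; left; exists [::].
case: n => [_|n]; first by exists 0 => h s _ _ _; right; exists [::].
move=> le_mn.
have [|N1 H1] := IH m n.+1; first by rewrite -ltnS.
have [|N2 H2] := IH m.+1 n; first by rewrite -ltnS -addnS.
exists (N1 + N2).+1 => h [|x s] //= /andP[xs us]; rewrite ltnS => Ns hs.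
have psym c u v : painted h c u v = painted h c v u by rewrite /painted orbC.
have extend c r : {subset r <= s} -> {in r, forall v, painted h c x v} ->
    uniq r -> {in r &, forall u v, u != v -> painted h c u v} ->
    [/\ uniq (x :: r), {subset x :: r <= x :: s} &
      {in x :: r &, forall u v, u != v -> painted h c u v}].
  move=> rs xr ur hr; split.
  - by rewrite /= ur andbT; apply: contra xs => /rs.
  - by move=> y; rewrite !inE => /orP[->//|/rs->]; rewrite orbT.
  - move=> u v; rewrite !inE => /orP[/eqP->|ur'] /orP[/eqP->|vr].
    + by rewrite eqxx.
    + by move=> _; apply: xr.
    + by move=> _; rewrite psym; apply: xr.
    + exact: hr.
pose A := [seq v <- s | painted h Red x v].
pose A' := [seq v <- s | ~~ painted h Red x v].
have sA : {subset A <= s} by move=> y; rewrite mem_filter => /andP[].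
have sA' : {subset A' <= s} by move=> y; rewrite mem_filter => /andP[].
have sz : size A + size A' = size s by rewrite !size_filter count_predC.
have wk r : {subset r <= s} -> {subset r <= x :: s}.
  by move=> rs y /rs; rewrite inE => ->; rewrite orbT.
have rA v : v \in A -> painted h Red x v by rewrite mem_filter => /andP[].
have bA' v : v \in A' -> painted h Blue x v.
  rewrite mem_filter => /andP[nr vs].
  have := hs x v; rewrite !inE eqxx vs orbT => /(_ isT isT).
  rewrite /adjacent (negbTE nr); apply.
  by apply: contraNneq xs => ->.
have [le1|lt1] := leqP N1 (size A).
  case: (H1 h A (filter_uniq _ us) le1) => [u v /sA uA /sA vA|[r [ur <- rsA hr]]|[r [ur rn rsA hr]]].
  - by apply: hs; rewrite inE ?uA ?vA orbT.
  - left; exists (x :: r).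
    have [||? ? ?] // := extend Red r _ _ ur hr; first by move=> y /rsA/sA.
    by move=> y /rsA/rA.
  - by right; exists r; split=> //; apply: wk => y /rsA/sA.
have le2 : N2 <= size A'.
  by rewrite -(leq_add2l N1) (leq_trans Ns)// -sz leq_add2r ltnW.
case: (H2 h A' (filter_uniq _ us) le2) => [u v /sA' uA /sA' vA|[r [ur rn rsA hr]]|[r [ur <- rsA hr]]].
- by apply: hs; rewrite inE ?uA ?vA orbT.
- by left; exists r; split=> //; apply: wk => y /rsA/sA'.
- right; exists (x :: r).
  have [||? ? ?] // := extend Blue r _ _ ur hr; first by move=> y /rsA/sA'.
  by move=> y /rsA/bA'.
Qed.

Lemma builder_forces_ex (m n : nat) : exists t, `[< builder_forces m n t >].
Proof.
have [N HN] := ramsey_bound m n.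
pose pairs := [seq e <- [seq (u, v) | u <- iota 0 N, v <- iota 0 N] | e.1 != e.2].
pose missing (h : history) := [seq e <- pairs | ~~ adjacent h e.1 e.2].
pose top (h : history) := (\max_(x <- h) maxn x.1.1 x.1.2).+1.
pose mv h := if missing h is e :: _ then e else (top h, (top h).+1).
have mv_legal h : legal h (mv h).
  rewrite /mv; case E: (missing h) => [|e r].
    have out x : x \in h -> (x.1.1 < top h) && (x.1.2 < top h).
      by move=> xh; rewrite -gtn_max ltnS; exact: (@leq_bigmax_seq _ h xpredT (fun x => maxn x.1.1 x.1.2)).
    rewrite /legal /= neq_ltn ltnSn /= /adjacent /painted.
    by apply/negP => /orP[] /orP[] /out /=; rewrite ltnn ?andbF.
  have : e \in missing h by rewrite E mem_head.
  by rewrite !mem_filter /legal => /and3P[-> ->].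
exists (size pairs); apply/asboolP; exists (Builder mv_legal) => P.
set B := Builder _.
have cnt k : size (missing (play B P k)) <= size pairs - k.
  elim: k => [|k IHk]; first by rewrite subn0 size_filter count_size.
  rewrite subnS; set h := play B P k in IHk *.
  have sub e : adjacent h e.1 e.2 -> adjacent (play B P k.+1) e.1 e.2.
    rewrite /adjacent /painted /= !inE -/h.
    by case/orP=> /orP[] ->; rewrite !orbT.
  have -> : missing (play B P k.+1) =
      [seq e <- missing h | ~~ adjacent (play B P k.+1) e.1 e.2].
    rewrite /missing -filter_predI; apply: eq_filter => e /=.
    by case: (boolP (adjacent h _ _)) => [/sub ->|_]; rewrite ?andbT.
  case E: (missing h) => [//|e r] /=.
  have -> : adjacent (play B P k.+1) e.1 e.2.
    rewrite /adjacent /painted /= /mv -/h E !inE -surjective_pairing.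
    by case: (P h e); rewrite eqxx ?orbT.
  rewrite /= size_filter (leq_trans (count_size _ _))//.
  by move: IHk; rewrite E /=; case: (size pairs - k).
exists (size pairs) => //.
apply: (HN _ (iota 0 N) (iota_uniq _ _)); rewrite ?size_iota// => u v uN vN uv.
have := cnt (size pairs); rewrite subnn leqn0 => /nilP M.
apply/negPn/negP => nadj.
suff : (u, v) \in missing (play B P (size pairs)) by rewrite M.
rewrite !mem_filter /= nadj uv /=; apply/allpairsP; exists (u, v).
by [].
Qed.

Definition online_ramsey (m n : nat) : nat := ex_minn (builder_forces_ex m n).

Definition diagonal_online_ramsey (n : nat) : nat := online_ramsey n n.

(* Main.v *)
Require Import Defs.
From mathcomp Require Import all_boot all_order all_fingroup all_algebra.
From mathcomp Require Import zify ring lra.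
From mathcomp Require Import boolp reals exp.

(* Painter answers with fair coin flips fixed in advance. A monochromatic K_n
   can be described before the game by n - c slots, each one of 2t values: c
   matching edges, each named by the turn on which it is placed, and n - 2c
   further vertices, each named by one endpoint of the edge of some turn. For
   a fixed description, every edge of the clique placed once both its ends are
   known has the right colour with probability 1/2, whatever Builder does.
   Taking the matching as early as possible in the clique, at most two of the
   four edges joining two matching edges come too early, and no others, so a
   description succeeds with probability at most 2^(c(c-1) - C(n,2)). If
   Builder forces a win in t turns the union bound thus gives
   2^(C(n,2) - c(c-1)) <= 2 (2t)^(n-c), and c = (1 - sqrt 2 / 2) n is the
   optimal choice. *)

Set Implicit Arguments.
Unset Strict Implicit.
Unset Printing Implicit Defensive.

(** * Coin flips and betting strategies *)

Fixpoint bitwords (t : nat) : seq (seq bool) :=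
  if t is t'.+1 then [seq rcons w b | w <- bitwords t', b <- [:: true; false]]
  else [:: [::]].

Lemma size_bitwords (t : nat) (w : seq bool) : w \in bitwords t -> size w = t.
Proof.
elim: t w => [w|t IHt w]; first by rewrite inE => /eqP->.
by case/allpairsPdep=> v [b] [/IHt <- _ ->]; rewrite size_rcons.
Qed.

(* A gambler who stakes everything on colour c at the turns selected by p. *)
Definition bet (p : pred (seq bool)) (c : bool) (w : seq bool) (r : nat) : nat :=
  if p (take r w) then 2 * (nth false w r == c) else 1.

Definition capital (p : pred (seq bool)) (c : bool) (w : seq bool) : nat :=
  \prod_(r < size w) bet p c w r.

Lemma capital_rcons (p : pred (seq bool)) (c : bool) (w : seq bool) (b : bool) :
  capital p c (rcons w b) = capital p c w * (if p w then 2 * (b == c) else 1).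
Proof.
rewrite /capital size_rcons big_ord_recr /=; congr (_ * _); last first.
  by rewrite /bet -cats1 take_size_cat// cats1 nth_rcons ltnn eqxx.
apply: eq_bigr => r _.
by rewrite /bet nth_rcons ltn_ord -cats1 takel_cat// ltnW.
Qed.

(** The bet is fair: with or without a stake, the capitals after the two possible flips add up to
    twice the capital before, so the mean over all words stays 1. *)
Lemma sum_capital (p : pred (seq bool)) (c : bool) (t : nat) :
  \sum_(w <- bitwords t) capital p c w = 2 ^ t.
Proof.
elim: t => [|t IHt]; first by rewrite big_seq1 /capital big_ord0.
rewrite [LHS]big_allpairs_dep expnSr -IHt big_distrl /=; apply: eq_bigr => w _.
rewrite !big_cons big_nil !capital_rcons addn0 -mulnDr.
by congr (_ * _); case: (p w); case: (c).
Qed.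

(** * The game against colours fixed in advance *)

Definition board (B : builder) (w : seq bool) : history :=
  foldl (fun h b => (B h, b) :: h) [::] w.

Definition edge (B : builder) (w : seq bool) (r : nat) : nat * nat :=
  B (board B (take r w)).

Definition joins (e : nat * nat) (u v : nat) : bool :=
  (e == (u, v)) || (e == (v, u)).

Lemma joinsC (e : nat * nat) (u v : nat) : joins e u v = joins e v u.
Proof. by rewrite /joins orbC. Qed.

Lemma board_rcons (B : builder) (w : seq bool) (b : bool) :
  board B (rcons w b) = (B (board B w), b) :: board B w.
Proof. by rewrite /board foldl_rcons. Qed.

Lemma size_board (B : builder) (w : seq bool) : size (board B w) = size w.
Proof.
by elim/last_ind: w => // w b IHw; rewrite board_rcons size_rcons /= IHw.
Qed.

(** The size of the history is the number of the current turn, so this Painter answers with the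
    letters of [w] in order. *)
Lemma play_board (B : builder) (w : seq bool) (k : nat) : k <= size w ->
  play B (fun h _ => nth false w (size h)) k = board B (take k w).
Proof.
elim: k => [|k IHk] ltkw; first by rewrite take0.
rewrite /= (take_nth false ltkw) board_rcons IHk ?(ltnW ltkw)//.
by rewrite size_board size_take ltkw.
Qed.

Lemma edge_take (B : builder) (w : seq bool) (r k : nat) :
  k <= r -> edge B (take r w) k = edge B w k.
Proof. by move=> lekr; rewrite /edge take_takel. Qed.

Lemma paintedP (B : builder) (w : seq bool) (c : bool) (u v : nat) :
  reflect
    (exists r, [/\ r < size w, joins (edge B w r) u v & nth false w r = c])
    (painted (board B w) c u v).
Proof.
elim/last_ind: w => [|w b IHw]; first by constructor=> -[r []].
have edgeE r : r <= size w -> edge B (rcons w b) r = edge B w r.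
  by move=> ler; rewrite -(edge_take B (rcons w b) ler) -cats1 take_size_cat.
have lastE : B (board B w) = edge B w (size w) by rewrite /edge take_size.
rewrite board_rcons lastE; apply: (iffP idP).
  rewrite /painted !inE orbACA => /orP[|/IHw[r [ltrw jr <-]]].
    rewrite !xpair_eqE -andb_orl => /andP[jw /eqP->].
    exists (size w); rewrite size_rcons edgeE// nth_rcons ltnn eqxx ltnSn.
    by split=> //; rewrite /joins eq_sym (eq_sym _ (v, u)).
  by exists r; rewrite size_rcons edgeE ?(ltnW ltrw)// nth_rcons ltrw ltnS ltnW.
case=> r []; rewrite size_rcons ltnS => lerw; rewrite edgeE// nth_rcons.
rewrite /painted !inE orbACA; case: ltngtP lerw => // [ltrw|->] _ jr.
  by move=> cr; apply/orP; right; apply/IHw; exists r.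
by move=> ->; case/orP: jr => /eqP->; rewrite eqxx ?orbT.
Qed.

(** Once an edge is placed its ends are adjacent, and legality forbids placing it again. *)
Lemma joins_edge_inj (B : builder) (w : seq bool) (u v r r' : nat) :
  r < size w -> r' < size w ->
  joins (edge B w r) u v -> joins (edge B w r') u v -> r = r'.
Proof.
wlog ltrr' : r r' / r < r'.
  move=> W; case: (ltngtP r r') => // [lt|gt] rw r'w jr jr'; first exact: W.
  by apply/esym/W.
move=> rw r'w jr jr'.
have /andP[_ /negP[]] := move_of_legal B (board B (take r' w)).
have painted_r u' v' : joins (edge B w r) u' v' ->
    adjacent (board B (take r' w)) u' v'.
  move=> jr''; suff: painted (board B (take r' w)) (nth false w r) u' v'.
    by rewrite /adjacent; case: nth => ->; rewrite ?orbT.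
  apply/paintedP; exists r; rewrite size_take r'w nth_take//.
  by rewrite edge_take ?(ltnW ltrr').
case/orP: jr' => /eqP; rewrite {1}/edge => -> /=; apply: painted_r => //.
by rewrite joinsC.
Qed.

Lemma joins_share (e : nat * nat) (u v u' v' : nat) :
  joins e u v -> joins e u' v' -> (u = u' /\ v = v') \/ (u = v' /\ v = u').
Proof.
by rewrite /joins => /orP[]/eqP-> /orP[]/eqP[-> ->]; [left|right|right|left].
Qed.

(** Takes the value [size w] on a pair that is never joined. *)
Definition time (B : builder) (w : seq bool) (u v : nat) : nat :=
  find (fun r => joins (edge B w r) u v) (iota 0 (size w)).

Lemma timeC (B : builder) (w : seq bool) (u v : nat) :
  time B w u v = time B w v u.
Proof. by apply: eq_find => r; rewrite joinsC. Qed.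

Lemma time_painted (B : builder) (w : seq bool) (c : bool) (u v : nat) :
  painted (board B w) c u v ->
  [/\ time B w u v < size w, joins (edge B w (time B w u v)) u v &
      nth false w (time B w u v) = c].
Proof.
case/paintedP=> r [rw jr <-].
have hr : has (fun r => joins (edge B w r) u v) (iota 0 (size w)).
  by apply/hasP; exists r => //; rewrite mem_iota.
have ltT : time B w u v < size w.
  by rewrite /time -{2}(size_iota 0 (size w)) -has_find.
have := nth_find 0 hr; rewrite -/(time _ _ _ _) nth_iota// add0n => jT.
by split=> //; rewrite (joins_edge_inj ltT rw jT jr).
Qed.

(** * Early matchings in a clique *)

(* Positions of a clique: the endpoints of c matching edges, and d others. *)
Definition position (c d : nat) : finType := ('I_c * bool + 'I_d)%type.

Lemma card_position (c d : nat) : #|position c d| = c.*2 + d.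
Proof. by rewrite card_sum card_prod !card_ord card_bool muln2. Qed.

Lemma expn2_lt_add (a b k : nat) : a != b -> a < k -> b < k ->
  2 ^ a + 2 ^ b < 2 ^ k.
Proof.
wlog: a b / a < b => [W|ltab _ _ ltbk].
  case: (ltngtP a b) => // lt _ ak bk; first by apply: W; rewrite // ltn_eqF.
  by rewrite addnC; apply: W; rewrite // ltn_eqF.
apply: (@leq_trans (2 ^ b.+1)); last by rewrite leq_exp2l.
by rewrite expnS mul2n -addnn ltn_add2r ltn_exp2l.
Qed.

(* T is the order of placement. Minimising the sum of 2^T over the matching
   forbids exchanging an edge for earlier ones. *)
Lemma cheap_matching (c d : nat) (T : position c d -> position c d -> nat) :
  (forall a b, T a b = T b a) ->
  (forall a b a' b', uniq [:: a; b; a'; b'] -> T a b != T a' b') ->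
  exists f : {perm position c d},
    let T' a b := T (f a) (f b) in
    let t i := T' (inl (i, false)) (inl (i, true)) in
    (forall i b k, t i <= T' (inl (i, b)) (inr k)) /\
    (forall i j b, i != j ->
      maxn (t i) (t j) <= maxn (T' (inl (i, false)) (inl (j, b)))
                               (T' (inl (i, true)) (inl (j, ~~ b)))).
Proof.
move=> Tsym Tdist.
pose t (f : {perm position c d}) i := T (f (inl (i, false))) (f (inl (i, true))).
pose cost f := \sum_i 2 ^ t f i.
case: (arg_minnP cost (i0 := 1%g) (P := xpredT)) => // f _ fmin; exists f => /=.
have tpermE (a b e : position c d) : (tperm a b * f)%g e = f (tperm a b e).
  by rewrite permM.
have inlE (u v : 'I_c * bool) :
  (inl u == inl v :> position c d) = (u == v) by [].
split=> [i b k|i j b neij].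
  rewrite leqNgt; apply/negP => ltTt.
  (* Trade the other end of edge [i] for the vertex at [k]: only the weight of edge [i] changes, and
     it drops. *)
  pose g := (tperm (inl (i, ~~ b)) (inr k) * f)%g.
  have := fmin g isT; apply/negP; rewrite -ltnNge /cost.
  rewrite (bigD1 i)//= [ltnRHS](bigD1 i)//=.
  rewrite (eq_bigr (fun l => 2 ^ t f l)) => [|l neli].
    rewrite ltn_add2r ltn_exp2l// /t /g !tpermE.
    case: b ltTt {g} => ltTt; rewrite tpermL tpermD ?inlE ?xpair_eqE ?andbF//.
    by rewrite Tsym.
  by rewrite /t /g !tpermE !tpermD//; apply: contra neli => /eqP[->].
rewrite leqNgt; apply/negP; rewrite gtn_max => /andP[lt1 lt2].
(* Replace edges [i] and [j] by the two crossing pairs. *)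
pose g := (tperm (inl (i, true)) (inl (j, b)) * f)%g.
have := fmin g isT; apply/negP; rewrite -ltnNge /cost.
have neji : j != i by rewrite eq_sym.
rewrite (bigD1 i)//= (bigD1 j)//= [ltnRHS](bigD1 i)//= [in ltnRHS](bigD1 j)//=.
rewrite (eq_bigr (fun l => 2 ^ t f l)) => [|l /andP[neli nelj]]; last first.
  rewrite /t /g !tpermE !tpermD// eq_sym; apply/eqP => -[] e *;
    by move: neli nelj; rewrite e ?eqxx.
rewrite !addnA ltn_add2r.
have -> : t g i = T (f (inl (i, false))) (f (inl (j, b))).
  rewrite /t /g !tpermE tpermL tpermD//; apply/eqP => -[] // e.
  by rewrite e eqxx in neij.
have -> : t g j = T (f (inl (i, true))) (f (inl (j, ~~ b))).
  rewrite /t /g !tpermE; case: (b); rewrite tpermR tpermD ?inlE ?xpair_eqE;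
    by rewrite ?(negbTE neij) ?andbF// Tsym.
(* Both new edges precede the later old one and have different times, so their weights together stay
   below its weight alone. *)
apply: (@leq_trans (2 ^ maxn (t f i) (t f j))).
  apply: expn2_lt_add lt1 lt2; apply: Tdist.
  rewrite -[[:: _; _; _; _]]/(map f [:: inl (i, false); inl (j, b);
                                        inl (i, true); inl (j, ~~ b)]).
  rewrite map_inj_uniq; last exact: perm_inj.
  rewrite /= !inE !inlE !xpair_eqE (negbTE neij) (negbTE neji) !eqxx.
  by case: (b).
by case: (leqP (t f i) (t f j)) => _; rewrite ?leq_addl ?leq_addr.
Qed.

(* The late pairs join two matching edges i and j, and each of the two perfect
   matchings of their four endpoints across i and j has at most one of them. *)
Lemma card_late_pairs (c d : nat) (T : position c d -> position c d -> nat)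
    (s : position c d -> nat) :
  (forall a b, T a b = T b a) ->
  (forall i b, s (inl (i, b)) = T (inl (i, false)) (inl (i, true))) ->
  (forall k b, b != inr k -> s (inr k) <= T (inr k) b) ->
  (forall i b k, s (inl (i, b)) <= T (inl (i, b)) (inr k)) ->
  (forall i j b b' b'', i != j ->
    maxn (s (inl (i, b'))) (s (inl (j, b'')))
      <= maxn (T (inl (i, false)) (inl (j, b)))
              (T (inl (i, true)) (inl (j, ~~ b)))) ->
  (c.*2 + d) * (c.*2 + d).-1 <=
    #|[set ab : position c d * position c d |
        (ab.1 != ab.2) && (maxn (s ab.1) (s ab.2) <= T ab.1 ab.2)]|
    + (c * c.-1).*2.
Proof.
move=> Tsym sl srr slr sll.
set G := [set ab | _].
pose off (I : finType) := [set ab : I * I | ab.1 != ab.2].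
have card_off (I : finType) : #|off I| = #|I| * #|I|.-1.
  have := cardsC (off I); rewrite card_prod.
  have -> : ~: off I = [set (a, a) | a in I].
    apply/setP=> -[a b]; rewrite !inE negbK /=.
    by apply/eqP/imsetP => [->|[e _ [-> ->]//]]; exists b.
  rewrite card_imset => [|a b [] //].
  by rewrite cardT -cardE; case: #|I| => [|n] /=; rewrite ?muln0 //= ?mulnS; lia.
rewrite -(card_position c d) -card_off.
have -> : #|off (position c d)| = #|G| + #|off _ :\: G|.
  rewrite -(cardsID G); congr (_ + _); apply: eq_card => ab; rewrite !inE.
  by case: eqP.
rewrite leq_add2l -muln2 -card_bool -[in leqRHS](card_ord c) -card_off.
rewrite -[leqRHS](_ : #|setX (off 'I_c) [set: bool]| = _); last first.
  by rewrite cardsX cardsT.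
have badP ab : ab \in off _ :\: G -> exists i j b b',
    [/\ ab = (inl (i, b), inl (j, b')), i != j &
    T (inl (i, b)) (inl (j, b')) < maxn (s (inl (i, b))) (s (inl (j, b')))].
  rewrite !inE; case: ab => a b /=; rewrite andbC => /andP[neab].
  rewrite neab /= -ltnNge.
  case: a b neab => [[i b]|k] [[j b']|k'] neab lt.
  - exists i, j, b, b'; split=> //; apply: contraTneq lt => eij; subst j.
    rewrite !sl maxnn -leqNgt; case: b b' neab => -[] //; rewrite ?eqxx// => _.
    by rewrite Tsym.
  - by move: lt; rewrite ltnNge geq_max slr Tsym srr.
  - by move: lt; rewrite ltnNge geq_max srr// Tsym slr.
  - by move: lt; rewrite ltnNge geq_max srr 1?eq_sym// Tsym srr// eq_sym.
(* An ordered late pair is coded by its two matching edges and the parity [b (+) b'], which names a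
   perfect matching across them. Two late pairs with one code would fill that matching, against
   [sll]. The value at [i0] is a dummy. *)
pose g (ab : position c d * position c d) (i0 : 'I_c) :=
  if ab is (inl (i, b), inl (j, b')) then ((i, j), b (+) b') else ((i0, i0), true).
have [->|[ab0 /badP[i0 _]]] := set_0Vmem (off _ :\: G); first by rewrite cards0.
rewrite -(@card_in_imset _ _ (g^~ i0)).
  apply/subset_leq_card/subsetP => _ /imsetP[ab /badP[i [j [b [b' [-> nij _]]]]] ->].
  by rewrite !inE /= nij.
move=> ab ab' /badP[i [j [b [b' [-> nij lt]]]]] /badP[i' [j' [e [e' [-> _ lt']]]]].
case=> ei ej; subst i' j' => eb.
suff eb1 : b = e by subst e; congr (inl _, inl (_, _)); apply: (addbI eb).
apply/eqP/negPn/negP => neb.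
have h := sll i j (b (+) b') b e' nij.
move: h lt lt'; rewrite !sl.
by case: b b' e e' eb neb => -[] [] [] //= _ _ h lt lt'; lia.
Qed.

(** * Descriptions of a clique and the bets they suggest *)

Definition side (b : bool) (e : nat * nat) : nat := if b then e.2 else e.1.

(** Both ends of a matching edge share a slot, so 2c + d positions cost only c + d slots; the bit
    tells the two ends apart. *)
Definition slot (c d : nat) (a : position c d) : ('I_c + 'I_d) * bool :=
  match a with inl (i, b) => (inl i, b) | inr k => (inr k, false) end.

(* For a matching edge the bit gives its orientation, for another vertex it
   selects an endpoint. *)
Definition forecast (c d t : nat) : finType :=
  {ffun 'I_c + 'I_d -> 'I_t * bool}.

Lemma card_forecast (c d t : nat) : #|forecast c d t| = (2 * t) ^ (c + d).
Proof.
by rewrite card_ffun card_prod card_bool card_sum !card_ord mulnC.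
Qed.

Definition due (c d t : nat) (s : forecast c d t) (a : position c d) : nat :=
  (s (slot a).1).1.

Definition vertex (c d t : nat) (B : builder) (s : forecast c d t)
    (w : seq bool) (a : position c d) : nat :=
  side ((s (slot a).1).2 (+) (slot a).2) (edge B w (due s a)).

(** A due turn may equal [size w]: the move of that turn depends on earlier flips only, so its ends
    are known before its colour. Thus matching edges are bet on too. *)
Definition foreseen (c d t : nat) (B : builder) (s : forecast c d t)
    (w : seq bool) : bool :=
  [exists a, exists b, [&& a != b, due s a <= size w, due s b <= size w &
    joins (B (board B w)) (vertex B s w a) (vertex B s w b)]].

(** For the description built from an early matching, every bet falls on a clique edge and wins, and
    all but at most c(c-1) clique edges are bet on. *)
Lemma clique_foreseen (c d t : nat) (B : builder) (w : seq bool) (col : bool) :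
  1 < c.*2 + d -> size w = t -> mono_clique (board B w) col (c.*2 + d) ->
  exists s : forecast c d t,
    2 ^ ('C(c.*2 + d, 2) - c * c.-1) <= capital (foreseen B s) col w.
Proof.
move=> n2 szw [S [uS szS hS]].
pose x0 (a : position c d) := nth 0 S (enum_rank a).
have x0_inS a : x0 a \in S.
  by rewrite mem_nth// szS -card_position ltn_ord.
have x0_inj : injective x0.
  move=> a b /eqP; rewrite nth_uniq ?szS -?card_position ?ltn_ord// => /eqP.
  by move/val_inj/enum_rank_inj.
have [|a b a' b'|f [f1 f2]] :=
  @cheap_matching c d (fun a b => time B w (x0 a) (x0 b)).
- by move=> a b; rewrite timeC.
- rewrite -(map_inj_uniq x0_inj) /= !inE !negb_or.
  move=> /and4P[/and3P[nab naa' nab'] /andP[nba' nbb'] na'b' _].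
  have [_ j _] := time_painted (hS _ _ (x0_inS a) (x0_inS b) nab).
  have [_ j' _] := time_painted (hS _ _ (x0_inS a') (x0_inS b') na'b').
  apply/eqP => eT; rewrite eT in j.
  by case: (joins_share j j') => -[e _]; rewrite e eqxx in naa' nab'.
pose x a := x0 (f a).
pose T a b := time B w (x a) (x b).
have x_inj : injective x by move=> a b /x0_inj/perm_inj.
have Tp a b : a != b ->
    [/\ T a b < t, joins (edge B w (T a b)) (x a) (x b) & nth false w (T a b) = col].
  move=> nab; rewrite -szw; apply: time_painted.
  by apply: hS; rewrite ?x0_inS// (inj_eq x_inj).
have Tsym a b : T a b = T b a by rewrite /T timeC.
have [s Hs] : exists s : forecast c d t, forall j : 'I_c + 'I_d,
    match j with
    | inl i => (s j).1 = T (inl (i, false)) (inl (i, true)) :> nat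
    | inr k => forall b, b != inr k -> (s j).1 <= T (inr k) b
    end /\ forall a, (slot a).1 = j ->
      x a = side ((s j).2 (+) (slot a).2) (edge B w (s j).1).
  suff /fin_all_exists[s Hs] : forall j : 'I_c + 'I_d, exists q : 'I_t * bool,
    match j with
    | inl i => q.1 = T (inl (i, false)) (inl (i, true)) :> nat
    | inr k => forall b, b != inr k -> q.1 <= T (inr k) b
    end /\ forall a, (slot a).1 = j ->
      x a = side (q.2 (+) (slot a).2) (edge B w q.1).
    by exists (finfun s) => j; rewrite ffunE.
  move=> [i|k].
    have nft : inl (i, false) != inl (i, true) :> position c d by apply/eqP => -[].
    have [ltT jT _] := Tp _ _ nft.
    exists (Ordinal ltT, (edge B w (T (inl (i, false)) (inl (i, true)))).1
                           != x (inl (i, false))).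
    split=> // -[[i' b]|k] //= [->]; move: jT; rewrite /joins.
    case/orP=> /eqP-> /=; first by rewrite eqxx; case: b.
    by rewrite (inj_eq x_inj) eq_sym nft; case: b.
  have [b0 nb0] : exists b, b != inr k :> position c d.
    have /card_gt0P[b] : 0 < #|[set~ inr k : position c d]|.
      by rewrite cardsC1 card_position -subn1 subn_gt0.
    by rewrite !inE; exists b.
  (* A further vertex is named by its earliest clique edge, hence is known in time for all of
     them. *)
  case: (@arg_minnP _ b0 (fun b => b != inr k) (T (inr k)) nb0) => b1 nb1 b1min.
  have nkb1 : inr k != b1 by rewrite eq_sym.
  have [ltT jT _] := Tp _ _ nkb1.
  exists (Ordinal ltT, (edge B w (T (inr k) b1)).1 != x (inr k)).
  split=> // -[[i' b]|k'] //= [->]; move: jT; rewrite /joins addbF.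
  case/orP=> /eqP-> /=; first by rewrite eqxx.
  by rewrite (inj_eq x_inj) nb1.
exists s.
have xE a : x a = vertex B s w a.
  by rewrite /vertex /due; case: (Hs (slot a).1) => _; apply.
have vE r a : due s a <= r -> vertex B s (take r w) a = x a.
  by move=> le; rewrite xE /vertex edge_take.
have foreP r : r < t -> foreseen B s (take r w) ->
    exists a b, [/\ a != b, due s a <= r, due s b <= r & r = T a b].
  move=> ltrt /existsP[a /existsP[b]]; rewrite size_takel ?szw ?(ltnW ltrt)//.
  case/and4P=> nab da db; rewrite !vE// => jr; exists a, b; split=> //.
  by have [ltT jT _] := Tp _ _ nab; apply: (joins_edge_inj _ _ jr jT); rewrite szw.
have Pfore a b : a != b -> due s a <= T a b -> due s b <= T a b ->
    foreseen B s (take (T a b) w).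
  move=> nab da db; have [ltT jT _] := Tp _ _ nab.
  apply/existsP; exists a; apply/existsP; exists b.
  by rewrite nab size_takel ?szw ?(ltnW ltT)// da db !vE.
pose F := [set r : 'I_t | foreseen B s (take r w)].
(* Each turn in [F] places a clique edge, whose colour is [col], so the capital doubles there. *)
have -> : capital (foreseen B s) col w = 2 ^ #|F|.
  rewrite /capital szw -prod_nat_const [RHS]big_mkcond; apply: eq_bigr => r _.
  rewrite inE /bet; case: ifP => // /(foreP r (ltn_ord r))[a [b [nab _ _ ->]]].
  by have [_ _ ->] := Tp _ _ nab; rewrite eqxx.
rewrite leq_exp2l//.
have dl i b : due s (inl (i, b)) = T (inl (i, false)) (inl (i, true)).
  by have [/= <-] := Hs (inl i).
have := @card_late_pairs c d T (due s) Tsym dl _ _ _.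
set G := [set ab | _] => HG.
have GF : #|G| <= #|F|.*2.
  have <- : #|setX F [set: bool]| = #|F|.*2 by rewrite cardsX cardsT card_bool muln2.
  have [t0|t0] := posnP t.
    suff -> : G = set0 by rewrite cards0.
    apply/setP => -[a b]; rewrite !inE /=; apply/negP => /andP[/Tp[lt _ _] _].
    by have := leq_trans lt (eq_leq t0).
  (* A turn in [F] accounts for the two orders of one clique edge; the bit tells which. *)
  pose g (ab : position c d * position c d) :=
    (insubd (Ordinal t0) (T ab.1 ab.2), (edge B w (T ab.1 ab.2)).1 == x ab.1).
  have gE a b : a != b -> val (g (a, b)).1 = T a b.
    by move=> /Tp[ltT _ _]; rewrite /g val_insubd ltT.
  rewrite -(@card_in_imset _ _ g).
    apply/subset_leq_card/subsetP => _ /imsetP[[a b] + ->].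
    rewrite !inE /= geq_max => /and3P[nab da db].
    by rewrite -[nat_of_ord _]/(val (g (a, b)).1) gE// Pfore.
  move=> [a b] [a' b']; rewrite !inE /= => /andP[nab _] /andP[na'b' _] eg.
  have eT : T a b = T a' b' by rewrite -gE// -[RHS]gE// eg.
  have [_ j _] := Tp _ _ nab; have [_ j' _] := Tp _ _ na'b'.
  have := congr1 snd eg; rewrite /g /= eT => e2; rewrite eT in j.
  case: (joins_share j j') => -[/x_inj ea /x_inj eb]; first by rewrite ea eb.
  subst a' b'; move: e2 nab; rewrite eq_sym.
  by case/orP: j => /eqP-> /=; rewrite eqxx (inj_eq x_inj); case: eqP.
have : #|G| + (c * c.-1).*2 >= (c.*2 + d) * (c.*2 + d).-1.
  apply: HG.
  - by move=> k b nb; have [/(_ b nb)] := Hs (inr k).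
  - by move=> i b k; rewrite dl; apply: f1.
  - by move=> i j b b' b'' nij; rewrite !dl; apply: f2.
rewrite bin2 => h; have := leq_trans h (leq_add GF (leqnn _)).
rewrite -doubleD => /half_leq; rewrite doubleK; lia.
Qed.

(** * The union bound *)

(** One gambler per description and colour: their total capital averages to the right-hand side,
    while on every word Builder's win makes one of them hold the left-hand side. *)
Lemma builder_forces_bound (c d t : nat) : 1 < c.*2 + d ->
  builder_forces (c.*2 + d) (c.*2 + d) t ->
  2 ^ ('C(c.*2 + d, 2) - c * c.-1) <= 2 * (2 * t) ^ (c + d).
Proof.
move=> n2 [B HB]; set M := 2 ^ _.
rewrite -(@leq_pmul2r (2 ^ t)) ?expn_gt0//.
have size_words k : \sum_(w <- bitwords k) 1 = 2 ^ k.
  rewrite -(sum_capital pred0 true k); apply: eq_bigr => w _.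
  by rewrite /capital big1.
rewrite -[X in _ <= 2 * X * _]card_forecast.
have -> : 2 * #|forecast c d t| * 2 ^ t =
    \sum_(w <- bitwords t) \sum_(col : bool) \sum_(s : forecast c d t)
      capital (foreseen B s) col w.
  rewrite exchange_big /= (eq_bigr (fun _ => #|forecast c d t| * 2 ^ t)).
    by rewrite sum_nat_const card_bool mulnA.
  move=> col _; rewrite exchange_big /= (eq_bigr (fun _ => 2 ^ t)).
    by rewrite sum_nat_const.
  by move=> s _; rewrite sum_capital.
rewrite -size_words big_distrr /= !big_seq; apply: leq_sum => w /size_bitwords szw.
rewrite muln1.
suff [col [s hs]] : exists col, exists s : forecast c d t,
    M <= capital (foreseen B s) col w.
  by rewrite (bigD1 col)//= (bigD1 s)//= -addnA (leq_trans hs)// leq_addr.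
(* Builder may win early, on turn [k]; the clique survives until turn [t]. *)
have [k kt] := HB (fun h _ => nth false w (size h)).
rewrite play_board ?szw//.
have grow col : mono_clique (board B (take k w)) col (c.*2 + d) ->
    mono_clique (board B w) col (c.*2 + d).
  move=> [S [uS szS hS]]; exists S; split=> // u v uin vin nuv.
  have /paintedP[r [rk jr <-]] := hS u v uin vin nuv.
  rewrite size_takel ?szw// in rk; apply/paintedP; exists r.
  by rewrite szw (leq_trans rk kt) -(edge_take B w (ltnW rk)) jr nth_take.
by case=> /grow /(clique_foreseen n2 szw)[s hs]; [exists true|exists false]; exists s.
Qed.

(** * Logarithms and the choice of c *)

Import Order.TTheory GRing.Theory Num.Theory.

Local Open Scope ring_scope.

Lemma builder_forces_powR (R : realType) (n c t : nat) (X : R) :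
  (1 < n)%N -> (c.*2 <= n)%N -> builder_forces n n t -> t%:R <= 2 `^ X ->
  (n%:R ^+ 2 - n%:R - 1) / 2 - c%:R * (c%:R - 1) <= 1 + (n%:R - c%:R) * (1 + X).
Proof.
move=> n1 cn forces tX.
have := @builder_forces_bound c (n - c.*2) t.
rewrite subnKC// => /(_ n1 forces).
have -> : (c + (n - c.*2) = n - c)%N by lia.
set e := (_ - _)%N => bound.
have eR : (n%:R ^+ 2 - n%:R - 1) / 2 - c%:R * (c%:R - 1) <= e%:R :> R.
  (* The 1 absorbs any rounding in the halving by [bin2]. *)
  have : (n * n + 2 * c <= 2 * e + 1 + n + 2 * (c * c))%N.
    have nE : (n * n = n * n.-1 + n)%N by rewrite -mulnSr prednK// ltnW.
    have cE : (c * c = c * c.-1 + c)%N by case: (c) => // m; rewrite -mulnSr.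
    by rewrite /e bin2 nE cE; lia.
  by rewrite -(ler_nat R) !natrD !natrM; lra.
apply: le_trans eR _.
have ln2 : 0 < ln (2 : R) by rewrite ln_gt0// ltr1n.
rewrite -(ler_pM2r ln2) -!ln_powR ler_ln ?posrE ?powR_gt0//.
have p2 (x y : R) : 2 `^ (x + y) = 2 `^ x * 2 `^ y.
  by rewrite powRD// pnatr_eq0 implybT.
rewrite p2 (mulrC (_ - _)) powRrM p2 !powRr1// -natrB; last lia.
rewrite !powR_mulrn ?mulr_ge0 ?powR_ge0//.
have -> : 2 ^+ e = (2 ^ e)%N%:R :> R by rewrite natrX.
apply: (@le_trans _ _ (2 * (2 * t) ^ (n - c))%N%:R); first by rewrite ler_nat.
rewrite natrM natrX natrM ler_pM2l// lerXn2r ?nnegrE ?mulr_ge0 ?powR_ge0//.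
by rewrite ler_pM2l.
Qed.

(** Here x is n, y is sqrt 2 n, and x - y/2 - e is c. At this optimal c the quadratic terms cancel
    and e meets neither x nor y in a product, so the positive linear part x/2 + y decides. *)
Lemma exponent_gap (R : realType) (x y e : R) :
  4 <= x -> x <= y -> y * y = 2 * (x * x) -> 0 <= e -> e * e <= e -> e <= 1 ->
  1 + (x - (x - y / 2 - e)) * (1 + (2 * x - y - 4)) <
  (x ^+ 2 - x - 1) / 2 - (x - y / 2 - e) * ((x - y / 2 - e) - 1).
Proof.
move=> x4 xy yy e0 ee e1.
rewrite -subr_gt0.
have -> : (x ^+ 2 - x - 1) / 2 - (x - y / 2 - e) * ((x - y / 2 - e) - 1) -
  (1 + (x - (x - y / 2 - e)) * (1 + (2 * x - y - 4))) =
  (y * y - 2 * (x * x)) / 4 - e * e + x / 2 + y + 2 * e - 3 / 2 by field.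
by rewrite yy subrr mul0r; lra.
Qed.

Theorem corollary2 (R : realType) :
  exists (C : R) (n0 : nat), forall n : nat, (n0 <= n)%N ->
    2 `^ ((2 - Num.sqrt 2) * n%:R - C) <= (diagonal_online_ramsey n)%:R.
Proof.
exists 4, 4%N => n n4; rewrite leNgt; apply/negP => /ltW small.
have s2 : Num.sqrt (2 : R) ^+ 2 = 2 by rewrite sqr_sqrtr.
have s0 : 0 <= Num.sqrt (2 : R) by rewrite sqrtr_ge0.
set s := Num.sqrt (2 : R) in s2 s0 small.
have s1 : 1 <= s by rewrite -(ler_pXn2r (ltn0Sn 1)) ?nnegrE// expr1n s2 ler1n.
have s4 : s <= 2 by rewrite -(ler_pXn2r (ltn0Sn 1)) ?nnegrE// s2 expr2; lra.
have n4R : (4 : R) <= n%:R by rewrite (ler_nat R 4).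
pose y := s * n%:R; rewrite mulrBl -/y in small.
have yge : n%:R <= y by rewrite ler_peMl//; lra.
have yle : y <= 2 * n%:R by rewrite ler_wpM2r//; lra.
have yy : y * y = 2 * (n%:R * n%:R) by rewrite mulrACA -expr2 s2.
have b0 : 0 <= n%:R - y / 2 by lra.
(* The optimal number of matching edges, rounded down; [e] below is the rounding error. *)
have [c /andP[cle clt]] : exists c : nat, c%:R <= n%:R - y / 2 < c.+1%:R.
  by exists (Num.trunc (n%:R - y / 2)); apply: truncn_itv.
rewrite -(natr1 c) in clt.
have n1 : (1 < n)%N by lia.
have cn : (c.*2 <= n)%N by rewrite -(ler_nat R) -muln2 natrM; lra.
have forces : builder_forces n n (diagonal_online_ramsey n).
  by rewrite /diagonal_online_ramsey /online_ramsey; case: ex_minnP => m /asboolP.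
have := builder_forces_powR n1 cn forces small.
pose e := n%:R - y / 2 - c%:R.
have -> : c%:R = n%:R - y / 2 - e by rewrite /e; lra.
have e0 : 0 <= e by rewrite /e; lra.
have e1 : e <= 1 by rewrite /e; lra.
have ee : e * e <= e by rewrite ler_piMr.
by rewrite leNgt exponent_gap.
Qed.
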